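(* Let $n, m \geq 2$ be integers (not necessarily coprime), and let $f : (\mathbb{C}^2, \boldsymbol{0}) \to (\mathbb{C}, 0)$ be a germ of a holomorphic function defining a semi-quasi-homogeneous singularity with initial term $y^n - x^m$. Let $\mu$ and $\tau$ be the Milnor number and the Tjurina number of $f$. Then $\mu/\tau < 4/3$.
   Context: For a germ $f : (\mathbb{C}^2, \boldsymbol{0}) \to (\mathbb{C}, 0)$ of a holomorphic function defining an isolated plane curve singularity, the Milnor number and the Tjurina number are $$\mu := \dim_{\mathbb{C}} \frac{\mathbb{C}\{x,y\}}{(\partial f/\partial x, \partial f/\partial y)}, \qquad \tau := \dim_{\mathbb{C}} \frac{\mathbb{C}\{x,y\}}{(f, \partial f/\partial x, \partial f/\partial y)}.$$ The germ $f$ is a semi-quasi-homogeneous singularity with weights $w = (n,m)$, where $n,m\ge 2$ and $\gcd(n,m)\ge 1$, and initial term $f_0 = y^n - x^m$ if $f = f_0 + g$ with $g \in \mathbb{C}\{x,y\}$ and $\deg_w(f_0) < \deg_w(g)$. Here $x$ has weight $n$ and $y$ has weight $m$, so $\deg_w(f_0)=nm$, and the condition means that every monomial $x^i y^j$ appearing in $g$ with nonzero coefficient satisfies $ni + mj > nm$. *)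

(* Defs.v *)
From HB Require Import structures.
From mathcomp Require Import all_boot all_order all_algebra.
From mathcomp Require Import boolp classical_sets functions.
From mathcomp Require Import complex.
Set Implicit Arguments.
Unset Strict Implicit.
Unset Printing Implicit Defensive.
Import Order.TTheory GRing.Theory Num.Theory.
Local Open Scope ring_scope.

(* Formal power series in two variables: a i j is the coefficient of
   x^i y^j.  The alias carries the Cauchy product, not the pointwise product
   that functions inherit from their codomain. *)
Definition pseries (K : comNzRingType) : Type := nat -> nat -> K.

Section FormalPowerSeries.
Variable K : comNzRingType.
Implicit Types a b c : pseries K.

HB.instance Definition _ :=
  GRing.Lmodule.copy (pseries K) (nat -> nat -> K^o).

Definition ps_one : pseries K := fun i j => ((i == 0) && (j == 0))%N%:R.

Definition ps_mul a b : pseries K := fun i j =>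
  \sum_(k < i.+1) \sum_(l < j.+1) a k l * b (i - k)%N (j - l)%N.

Definition ps_trunc n a : {poly {poly K}} :=
  \poly_(i < n) (\poly_(j < n) a i j).

Lemma coef_ps_trunc n a i j : (i < n)%N -> (j < n)%N ->
  (ps_trunc n a)`_i`_j = a i j.
Proof. by move=> lin ljn; rewrite coef_poly lin coef_poly ljn. Qed.

Lemma ps_truncM n a b i j : (i < n)%N -> (j < n)%N ->
  (ps_trunc n a * ps_trunc n b)`_i`_j = ps_mul a b i j.
Proof.
move=> lin ljn; rewrite coefM coef_sum; apply: eq_bigr => k _.
rewrite coefM; apply: eq_bigr => l _.
have kn : (k < n)%N by rewrite (leq_ltn_trans _ lin) ?leq_ord.
have ln : (l < n)%N by rewrite (leq_ltn_trans _ ljn) ?leq_ord.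
by rewrite !coef_ps_trunc ?(leq_ltn_trans (leq_subr _ _)).
Qed.

Lemma eq_ps_mul a a' b b' i j :
  (forall k l, (k <= i)%N -> (l <= j)%N -> a k l = a' k l) ->
  (forall k l, (k <= i)%N -> (l <= j)%N -> b k l = b' k l) ->
  ps_mul a b i j = ps_mul a' b' i j.
Proof.
move=> ea eb; apply: eq_bigr => k _; apply: eq_bigr => l _.
by rewrite ea ?eb ?leq_subr ?leq_ord.
Qed.

Definition ps_coefs (p : {poly {poly K}}) : pseries K := fun i j => p`_i`_j.

Lemma ps_coefsM p q : ps_coefs (p * q) = ps_mul (ps_coefs p) (ps_coefs q).
Proof.
apply/funext => i; apply/funext => j; rewrite /ps_coefs coefM coef_sum.
by apply: eq_bigr => k _; rewrite coefM.
Qed.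

Lemma ps_mulC : commutative ps_mul.
Proof.
move=> a b; apply/funext => i; apply/funext => j.
pose n := (maxn i j).+1.
have [li lj] : (i < n)%N /\ (j < n)%N by rewrite !ltnS leq_maxl leq_maxr.
by rewrite -(ps_truncM a b li lj) mulrC ps_truncM.
Qed.

Lemma ps_mulA : associative ps_mul.
Proof.
move=> a b c; apply/funext => i; apply/funext => j.
pose n := (maxn i j).+1.
have [li lj] : (i < n)%N /\ (j < n)%N by rewrite !ltnS leq_maxl leq_maxr.
have tE d k l : (k <= i)%N -> (l <= j)%N -> d k l = ps_coefs (ps_trunc n d) k l.
  move=> ki lj'; rewrite /ps_coefs coef_ps_trunc //.
    exact: leq_ltn_trans li.
  exact: leq_ltn_trans lj.
have tM d e k l : (k <= i)%N -> (l <= j)%N ->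
    ps_mul d e k l = ps_coefs (ps_trunc n d * ps_trunc n e) k l.
  move=> ki lj'; rewrite /ps_coefs ps_truncM //.
    exact: leq_ltn_trans li.
  exact: leq_ltn_trans lj.
rewrite (eq_ps_mul (tE a) (tM b c)) (eq_ps_mul (tM a b) (tE c)).
by rewrite -!ps_coefsM mulrA.
Qed.

Lemma ps_mul1 : left_id ps_one ps_mul.
Proof.
move=> a; apply/funext => i; apply/funext => j.
rewrite /ps_mul big_ord_recl /= big_ord_recl /= /ps_one /= mul1r !subn0.
rewrite !big1 ?addr0 // => [k _|k _]; last by rewrite mul0r.
by rewrite big1 // => l _; rewrite mul0r.
Qed.

Lemma ps_mulDl : left_distributive ps_mul +%R.
Proof.
move=> a b c; apply/funext => i; apply/funext => j.
rewrite -[RHS]/(ps_mul a c i j + ps_mul b c i j) /ps_mul -big_split /=.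
apply: eq_bigr => k _; rewrite -big_split /=; apply: eq_bigr => l _.
exact: mulrDl.
Qed.

Lemma ps_one_neq0 : ps_one != 0.
Proof.
apply/eqP => /(congr1 (fun a => a 0%N 0%N)) /eqP.
by rewrite /ps_one /= (negPf (oner_neq0 K)).
Qed.

HB.instance Definition _ := GRing.Zmodule_isComNzRing.Build (pseries K)
  ps_mulA ps_mulC ps_mul1 ps_mulDl ps_one_neq0.

Lemma ps_scalerAl (k : K) (a b : pseries K) : k *: (a * b) = k *: a * b.
Proof.
apply/funext => i; apply/funext => j.
rewrite -[LHS]/(k * ps_mul a b i j) -[RHS]/(ps_mul (k *: a) b i j) /ps_mul.
rewrite mulr_sumr; apply: eq_bigr => u _; rewrite mulr_sumr.
by apply: eq_bigr => v _; rewrite mulrA.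
Qed.

HB.instance Definition _ :=
  GRing.Lmodule_isLalgebra.Build K (pseries K) ps_scalerAl.
HB.instance Definition _ := GRing.Lalgebra_isComAlgebra.Build K (pseries K).

End FormalPowerSeries.

Section ConvergentPowerSeries.
Variable C : numFieldType.
Implicit Types a b : pseries C.

(* Absolute convergence on some polydisc.  When C is the field of complex
   numbers, 0 < r forces r to be real. *)
Definition ps_convergent a : Prop := exists2 r : C, 0 < r &
  exists M : C, forall N : nat,
    \sum_(i < N) \sum_(j < N) `|a i j| * r ^+ (i + j) <= M.

Definition ps_convergentb : pred (pseries C) := fun a => `[< ps_convergent a >].

Lemma ps_convergent_le a (r s M : C) : 0 < s -> s <= r ->
  (forall N, \sum_(i < N) \sum_(j < N) `|a i j| * r ^+ (i + j) <= M) ->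
  forall N, \sum_(i < N) \sum_(j < N) `|a i j| * s ^+ (i + j) <= M.
Proof.
move=> s0 sr h N; apply: le_trans (h N); apply: ler_sum => i _.
apply: ler_sum => j _; apply: ler_wpM2l => //.
by apply: lerXn2r => //; rewrite nnegrE ?ltW // (lt_le_trans s0).
Qed.

Lemma ps_convergent2 a b : ps_convergent a -> ps_convergent b ->
  exists2 r : C, 0 < r & exists Ma Mb : C, forall N,
    \sum_(i < N) \sum_(j < N) `|a i j| * r ^+ (i + j) <= Ma /\
    \sum_(i < N) \sum_(j < N) `|b i j| * r ^+ (i + j) <= Mb.
Proof.
move=> [r r0 [Ma ha]] [s s0 [Mb hb]].
have /orP[rs|sr] := real_leVge (gtr0_real r0) (gtr0_real s0).
  by exists r => //; exists Ma, Mb => N; split;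
    [exact: ha | exact: (ps_convergent_le r0 rs hb)].
by exists s => //; exists Ma, Mb => N; split;
  [exact: (ps_convergent_le s0 sr ha) | exact: hb].
Qed.

Lemma sum_cauchy_le (F : nat -> nat -> C) N : (forall k l, 0 <= F k l) ->
  \sum_(i < N) \sum_(k < i.+1) F k (i - k)%N <= \sum_(k < N) \sum_(l < N) F k l.
Proof.
move=> F0.
under eq_bigr => i _ do
  rewrite (big_ord_widen N (fun k => F k (i - k)%N)) //.
rewrite (exchange_big_dep xpredT) //=; apply: ler_sum => k _.
rewrite -(big_mkord xpredT (F k)).
rewrite (eq_bigl (fun i : 'I_N => (k <= i)%N)); last by move=> i; rewrite ltnS.
rewrite -(big_geq_mkord k N xpredT (fun i => F k (i - k)%N)).
rewrite -{1}[k : nat]add0n big_addn.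
under eq_bigr => i _ do rewrite addnK.
rewrite [leRHS](@big_cat_nat _ _ _ (N - k)%N) ?leq_subr //=.
by rewrite lerDl sumr_ge0.
Qed.

Lemma ps_convergentM a b :
  ps_convergent a -> ps_convergent b -> ps_convergent (a * b).
Proof.
move=> ca cb; have [r r0 [Ma [Mb h]]] := ps_convergent2 ca cb.
have r0' := ltW r0.
exists r => //; exists (Ma * Mb) => N.
pose A i j := `|a i j| * r ^+ (i + j); pose B i j := `|b i j| * r ^+ (i + j).
have A0 i j : 0 <= A i j by rewrite mulr_ge0 ?exprn_ge0.
have B0 i j : 0 <= B i j by rewrite mulr_ge0 ?exprn_ge0.
pose G k k' l l' := A k l * B k' l'.
have G0 k k' l l' : 0 <= G k k' l l' by rewrite mulr_ge0.
apply: (@le_trans _ _ (\sum_(i < N) \sum_(j < N) \sum_(k < i.+1)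
    \sum_(l < j.+1) G k (i - k)%N l (j - l)%N)).
  apply: ler_sum => i _; apply: ler_sum => j _.
  rewrite -[(a * b) i j]/(ps_mul a b i j).
  apply: (le_trans (ler_wpM2r (exprn_ge0 _ r0') (ler_norm_sum _ _ _))).
  rewrite mulr_suml; apply: ler_sum => k _.
  apply: (le_trans (ler_wpM2r (exprn_ge0 _ r0') (ler_norm_sum _ _ _))).
  rewrite mulr_suml; apply: ler_sum => l _; rewrite normrM /G /A /B.
  have -> : (i + j = (k + l) + ((i - k) + (j - l)))%N.
    by rewrite addnACA !subnKC ?leq_ord.
  by rewrite exprD mulrACA.
apply: (@le_trans _ _ (\sum_(k < N) \sum_(k' < N) \sum_(l < N) \sum_(l' < N)
    G k k' l l')).
  under eq_bigr => i _ do rewrite exchange_big /=.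
  pose F k k' := \sum_(j < N) \sum_(l < j.+1) G k k' l (j - l)%N.
  apply: (@le_trans _ _ (\sum_(k < N) \sum_(k' < N) F k k')).
    apply: (sum_cauchy_le (F := F)) => k k'.
    by apply: sumr_ge0 => j _; apply: sumr_ge0.
  apply: ler_sum => k _; apply: ler_sum => k' _.
  exact: (sum_cauchy_le (F := G k k')).
have -> : \sum_(k < N) \sum_(k' < N) \sum_(l < N) \sum_(l' < N) G k k' l l'
    = (\sum_(i < N) \sum_(j < N) A i j) * (\sum_(i < N) \sum_(j < N) B i j).
  rewrite mulr_suml; apply: eq_bigr => k _; rewrite mulr_sumr.
  apply: eq_bigr => k' _; rewrite mulr_suml; apply: eq_bigr => l _.
  by rewrite mulr_sumr.
have [hA hB] := h N.
by apply: ler_pM => //; apply: sumr_ge0 => i _; apply: sumr_ge0.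
Qed.

Lemma ps_convergentD a b :
  ps_convergent a -> ps_convergent b -> ps_convergent (a + b).
Proof.
move=> ca cb; have [r r0 [Ma [Mb h]]] := ps_convergent2 ca cb.
exists r => //; exists (Ma + Mb) => N; have [hA hB] := h N.
apply: le_trans (lerD hA hB); rewrite -big_split /=; apply: ler_sum => i _.
rewrite -big_split /=; apply: ler_sum => j _; rewrite -mulrDl.
apply: ler_wpM2r; first by rewrite exprn_ge0 // ltW.
exact: (ler_normD (a i j) (b i j)).
Qed.

Lemma ps_convergentZ (k : C) a : ps_convergent a -> ps_convergent (k *: a).
Proof.
move=> [r r0 [M h]]; exists r => //; exists (`|k| * M) => N.
apply: le_trans (ler_wpM2l (normr_ge0 k) (h N)).
rewrite mulr_sumr; apply: ler_sum => i _; rewrite mulr_sumr.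
by apply: ler_sum => j _; rewrite mulrA -[`|k| * _]normrM.
Qed.

Lemma ps_convergent_monom (p q : nat) :
  ps_convergent (fun i j => ((i == p) && (j == q))%:R).
Proof.
exists 1 => //; exists 1 => N.
under eq_bigr => i _.
  under eq_bigr => j _ do rewrite expr1n mulr1 normr_nat -mulnb natrM.
  rewrite -mulr_sumr; over.
rewrite -mulr_suml -[leRHS]mulr1.
have h (s : nat) : (\sum_(i < N) ((i == s :> nat)%:R : C)) <= 1.
  have [sN|Ns] := ltnP s N.
    by rewrite (bigD1 (Ordinal sN)) //= eqxx big1 ?addr0 // => i /negPf ni;
      rewrite -val_eqE /= in ni; rewrite ni.
  rewrite big1 // => i _; rewrite ltn_eqF //.
  exact: leq_trans (ltn_ord i) Ns.
by apply: ler_pM => //; apply: sumr_ge0.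
Qed.

Lemma ps_convergent_subalg : GRing.subsemialg_closed ps_convergentb.
Proof.
split.
- apply/asboolP; exact: ps_convergent_monom 0%N 0%N.
- split=> [|a b /asboolP ca /asboolP cb]; last exact/asboolP/ps_convergentD.
  apply/asboolP; rewrite -(scale0r (0 : pseries C)).
  apply: ps_convergentZ; exists 1 => //; exists 0 => N.
  by rewrite big1 // => i _; rewrite big1 // => j _; rewrite normr0 mul0r.
- by move=> k a /asboolP ca; exact/asboolP/ps_convergentZ.
- by move=> a b /asboolP ca /asboolP cb; exact/asboolP/ps_convergentM.
Qed.

Record cps : Type := CPS { coef : pseries C; coefP : ps_convergentb coef }.

HB.instance Definition _ := [isSub for coef].
HB.instance Definition _ := [Choice of cps by <:].
HB.instance Definition _ :=
  GRing.SubChoice_isSubAlgebra.Build C _ _ cps ps_convergent_subalg.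
HB.instance Definition _ :=
  GRing.SubNzRing_isSubComNzRing.Build (pseries C) ps_convergentb cps.

Definition cpsX : cps := CPS (asboolT (ps_convergent_monom 1 0)).
Definition cpsY : cps := CPS (asboolT (ps_convergent_monom 0 1)).

Definition ps_dx a : pseries C := fun i j => a i.+1 j *+ i.+1.
Definition ps_dy a : pseries C := fun i j => a i j.+1 *+ j.+1.

Lemma mulrn_exp_half (x r : C) n (k : nat) : 0 <= x -> 0 < r -> (k < n)%N ->
  x *+ k.+1 * (r / 2) ^+ n <= x * r ^+ n.
Proof.
move=> x0 r0 kn; rewrite expr_div_n -(mulr_natr x) -mulrA ler_wpM2l //.
rewrite mulrCA ler_piMr ?exprn_ge0 ?(ltW r0) // ler_pdivrMr ?exprn_gt0 // mul1r.
by rewrite -natrX ler_nat (leq_trans kn) // ltnW // ltn_expl.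
Qed.

Lemma ps_convergent_dx a : ps_convergent a -> ps_convergent (ps_dx a).
Proof.
move=> [r r0 [M h]]; have h0 : 0 < r / 2 by rewrite divr_gt0.
exists (r / 2) => //; exists (M / (r / 2)) => N; rewrite ler_pdivlMr //.
apply: le_trans (h N.+1).
rewrite big_ord_recl /= -[leLHS]add0r lerD //.
  by apply: sumr_ge0 => j _; rewrite mulr_ge0 ?exprn_ge0 // ltW.
rewrite mulr_suml; apply: ler_sum => i _.
rewrite big_ord_recr /= -[leLHS]addr0 lerD //; last first.
  by rewrite mulr_ge0 ?exprn_ge0 // ltW.
rewrite mulr_suml; apply: ler_sum => j _.
rewrite -mulrA -exprSr normrMn /bump /= add1n addSn.
by apply: mulrn_exp_half; rewrite // ltnS leq_addr.
Qed.

Lemma ps_convergent_dy a : ps_convergent a -> ps_convergent (ps_dy a).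
Proof.
move=> [r r0 [M h]]; have h0 : 0 < r / 2 by rewrite divr_gt0.
exists (r / 2) => //; exists (M / (r / 2)) => N; rewrite ler_pdivlMr //.
apply: le_trans (h N.+1).
rewrite big_ord_recr /= -[leLHS]addr0 lerD //; last first.
  by apply: sumr_ge0 => j _; rewrite mulr_ge0 ?exprn_ge0 // ltW.
rewrite mulr_suml; apply: ler_sum => i _.
rewrite big_ord_recl /= -[leLHS]add0r lerD //.
  by rewrite mulr_ge0 ?exprn_ge0 // ltW.
rewrite mulr_suml; apply: ler_sum => j _.
rewrite -mulrA -exprSr normrMn /bump /= add1n addnS.
by apply: mulrn_exp_half; rewrite // ltnS leq_addl.
Qed.

Lemma cps_convergent (f : cps) : ps_convergent (coef f).
Proof. exact/asboolP/coefP. Qed.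

Definition cps_dx (f : cps) : cps :=
  CPS (asboolT (ps_convergent_dx (cps_convergent f))).
Definition cps_dy (f : cps) : cps :=
  CPS (asboolT (ps_convergent_dy (cps_convergent f))).

End ConvergentPowerSeries.

Definition ideal_gen (A : comNzRingType) (s : seq A) : set A :=
  [set h | exists c : 'I_(size s) -> A, h = \sum_i c i * s`_i].

(* dim_K (V / W) = d: some d vectors of V induce a basis of V / W. *)
Definition quotient_dim (K : fieldType) (V : lmodType K) (W : set V) (d : nat) :
    Prop :=
  exists e : 'I_d -> V,
    (forall v, exists c : 'I_d -> K, W (v - \sum_i c i *: e i)) /\
    (forall c : 'I_d -> K, W (\sum_i c i *: e i) -> forall i, c i = 0).

Definition milnor_number (C : numFieldType) (f : cps C) (mu : nat) : Prop :=
  quotient_dim (ideal_gen [:: cps_dx f; cps_dy f]) mu.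

Definition tjurina_number (C : numFieldType) (f : cps C) (tau : nat) : Prop :=
  quotient_dim (ideal_gen [:: f; cps_dx f; cps_dy f]) tau.

(* x has weight n and y has weight m; the case g = 0 is included. *)
Definition semi_quasi_homogeneous (C : numFieldType) (n m : nat) (f : cps C) :
    Prop :=
  exists g : cps C,
    f = (cpsY C ^+ n - cpsX C ^+ m) + g /\
    forall i j : nat, coef g i j != 0 -> (n * m < n * i + m * j)%N.

(* Main.v *)
Require Import Defs.
From mathcomp Require Import all_boot all_order all_algebra.
From mathcomp Require Import boolp classical_sets.
From mathcomp Require Import reals complex ring zify.
Set Implicit Arguments.
Unset Strict Implicit.
Unset Printing Implicit Defensive.
Import Order.TTheory GRing.Theory Num.Theory.
Local Open Scope ring_scope.

(* Let J = (fx, fy), with x of weight n and y of weight m.  The monomials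
   x^i y^j with i < m - 1 and j < n - 1 are a basis modulo J: dividing by the
   initial terms x^(m-1) and y^(n-1) pushes the rest into arbitrarily high
   weight, where Nakayama's lemma puts it in J, and the initial terms are
   coprime.  So mu = (n - 1)(m - 1), and mu - tau is the rank of the
   multiplication by f on this basis.
   By Euler's relation f is congruent modulo J to some h all of whose terms
   have weight > n m.  Put t = max(0, (n m - 2 n - 2 m) / 2), rounded up.  The
   basis monomials of weight < t contribute at most their number to the rank,
   and those of weight >= t are mapped by h into weight > n m + t, where by the
   central symmetry of the basis there are again few monomials.  Both numbers
   are at most c, the number of pairs (a, b) of positive integers with
   2 (n a + m b) < n m, so mu - tau <= 2 c; finally 8 c < (n - 1)(m - 1). *)

(** * Coefficients, monomials and shifts of convergent power series *)

Section Coefficients.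
Variable C : numFieldType.
Implicit Types u v a b : cps C.

Lemma cpsP u v : (forall i j, coef u i j = coef v i j) -> u = v.
Proof. by move=> e; apply/val_inj/funext => i; apply/funext => j; apply: e. Qed.

Lemma cps_coef0 i j : coef (0 : cps C) i j = 0.
Proof. by []. Qed.

Lemma cps_coefD u v i j : coef (u + v) i j = coef u i j + coef v i j.
Proof. by []. Qed.

Lemma cps_coefN u i j : coef (- u) i j = - coef u i j.
Proof. by []. Qed.

Lemma cps_coefB u v i j : coef (u - v) i j = coef u i j - coef v i j.
Proof. by []. Qed.

Lemma cps_coefZ (k : C) u i j : coef (k *: u) i j = k * coef u i j.
Proof. by []. Qed.

Lemma cps_coefM u v i j :
  coef (u * v) i j =
  \sum_(k < i.+1) \sum_(l < j.+1) coef u k l * coef v (i - k)%N (j - l)%N.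
Proof. by []. Qed.

Lemma cps_coef_sum (I : Type) (r : seq I) (P : pred I) (F : I -> cps C) i j :
  coef (\sum_(k <- r | P k) F k) i j = \sum_(k <- r | P k) coef (F k) i j.
Proof. by elim/big_rec2: _ => // k x y _ <-. Qed.

Definition mon (p q : nat) : cps C := CPS (asboolT (ps_convergent_monom C p q)).

Lemma coef_mon p q i j : coef (mon p q) i j = ((i == p) && (j == q))%:R.
Proof. by []. Qed.

Lemma coef_monM p q v i j :
  coef (mon p q * v) i j =
  if (p <= i)%N && (q <= j)%N then coef v (i - p)%N (j - q)%N else 0.
Proof.
rewrite cps_coefM; have [/andP[pi qj]|npq] := boolP (_ && _).
  rewrite (bigD1 (inord p)) //= [X in _ + X]big1 ?addr0 => [|k nk]; last first.
    apply: big1 => l _; case: (_ =P p) => [ek|_]; last by rewrite mul0r.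
    by rewrite -val_eqE /= ek inordK ?ltnS ?eqxx in nk.
  rewrite (bigD1 (inord q)) //= [X in _ + X]big1 ?addr0 => [|l nl]; last first.
    case: (_ =P q) => [el|_]; last by rewrite andbF mul0r.
    by rewrite -val_eqE /= el inordK ?ltnS ?eqxx in nl.
  by rewrite !inordK ?ltnS // !eqxx mul1r.
rewrite big1 // => k _; rewrite big1 // => l _; rewrite coef_mon.
case: eqP => [ek|_]; last by rewrite mul0r.
case: eqP => [el|_]; last by rewrite mul0r.
by move: npq; rewrite -ek -el !leq_ord.
Qed.

Lemma monM p q p' q' : mon p q * mon p' q' = mon (p + p') (q + q').
Proof.
apply: cpsP => i j; rewrite coef_monM !coef_mon.
case: ifP => [/andP[pi qj]|npq].
  by rewrite -(eqn_add2l p (i - p)) -(eqn_add2l q (j - q)) !subnKC.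
have [ei|_] := eqVneq i (p + p')%N; last by [].
have [ej|_] := eqVneq j (q + q')%N; last by [].
by rewrite ei ej !leq_addr in npq.
Qed.

Lemma mon00 : mon 0 0 = 1.
Proof. exact: cpsP. Qed.

Lemma exp_cpsX p : cpsX C ^+ p = mon p 0.
Proof.
elim: p => [|p IH]; first by rewrite mon00.
by rewrite exprS IH -[cpsX C]/(mon 1 0) monM.
Qed.

Lemma exp_cpsY q : cpsY C ^+ q = mon 0 q.
Proof.
elim: q => [|q IH]; first by rewrite mon00.
by rewrite exprS IH -[cpsY C]/(mon 0 1) monM.
Qed.

Lemma ps_convergent_bound (a b : pseries C) :
  (forall i j, `|a i j| <= `|b i j|) -> ps_convergent b -> ps_convergent a.
Proof.
move=> ab [r r0 [M h]]; exists r => //; exists M => N.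
apply: le_trans (h N); apply: ler_sum => i _; apply: ler_sum => j _.
by rewrite ler_wpM2r ?exprn_ge0 ?(ltW r0).
Qed.

(** Convergence is inherited one shift at a time: the shifted coefficients are bounded by those of
    the derivative, which carry an extra factor of at least 1. *)
Lemma exists_shiftx p v : exists w, forall i j, coef w i j = coef v (i + p)%N j.
Proof.
elim: p => [|p [w wE]]; first by exists v => i j; rewrite addn0.
have cw : ps_convergent (fun i j => coef w i.+1 j).
  apply: ps_convergent_bound (ps_convergent_dx (cps_convergent w)) => i j.
  by rewrite /ps_dx normrMn mulrS lerDl mulrn_wge0.
by exists (CPS (asboolT cw)) => i j; rewrite -addSnnS -wE.
Qed.

Lemma exists_shifty q v : exists w, forall i j, coef w i j = coef v i (j + q)%N.
Proof.
elim: q => [|q [w wE]]; first by exists v => i j; rewrite addn0.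
have cw : ps_convergent (fun i j => coef w i j.+1).
  apply: ps_convergent_bound (ps_convergent_dy (cps_convergent w)) => i j.
  by rewrite /ps_dy normrMn mulrS lerDl mulrn_wge0.
by exists (CPS (asboolT cw)) => i j; rewrite -addSnnS -wE.
Qed.

End Coefficients.

(** * Inverses of convergent series with constant term 1 *)

Section Units.
Variable C : numFieldType.
Implicit Types (a b : pseries C) (r : C).

Definition ps_norm r a N : C :=
  \sum_(i < N) \sum_(j < N) `|a i j| * r ^+ (i + j).

Lemma ps_norm_ge0 r a N : 0 <= r -> 0 <= ps_norm r a N.
Proof.
by move=> r0; do 2!apply: sumr_ge0 => ? _; rewrite mulr_ge0 ?exprn_ge0.
Qed.

(** Coefficients of the product with indices below [N] only involve coefficients of the factors with
    indices below [N], so submultiplicativity already holds for the truncated norms. *)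
Lemma ps_normM r a b N : 0 <= r ->
  ps_norm r (a * b) N <= ps_norm r a N * ps_norm r b N.
Proof.
move=> r0.
pose A i j := `|a i j| * r ^+ (i + j); pose B i j := `|b i j| * r ^+ (i + j).
pose G k k' l l' := A k l * B k' l'.
have G0 k k' l l' : 0 <= G k k' l l' by rewrite !mulr_ge0 ?exprn_ge0.
apply: (@le_trans _ _ (\sum_(i < N) \sum_(j < N) \sum_(k < i.+1)
    \sum_(l < j.+1) G k (i - k)%N l (j - l)%N)).
  do 2!apply: ler_sum => ? _.
  apply: (le_trans (ler_wpM2r (exprn_ge0 _ r0) (ler_norm_sum _ _ _))).
  rewrite mulr_suml; apply: ler_sum => k _.
  apply: (le_trans (ler_wpM2r (exprn_ge0 _ r0) (ler_norm_sum _ _ _))).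
  rewrite mulr_suml; apply: ler_sum => l _; rewrite normrM /G mulrACA -exprD.
  by rewrite addnACA !subnKC ?leq_ord.
under eq_bigr => i _ do rewrite exchange_big /=.
apply: le_trans (sum_cauchy_le
  (F := fun k k' => \sum_(j < N) \sum_(l < j.+1) G k k' l (j - l)%N) N _) _.
  by move=> k k'; do 2!apply: sumr_ge0 => ? _.
rewrite mulr_suml; apply: ler_sum => k _; rewrite mulr_sumr.
apply: ler_sum => k' _.
apply: le_trans (sum_cauchy_le (F := G k k') N _) _ => //.
by rewrite mulr_suml; apply: ler_sum => l _; rewrite mulr_sumr.
Qed.

(** Without a constant term every term carries a factor [r], so multiplying the radius by [q <= 1]
    multiplies the bound by [q]. *)
Lemma ps_norm_small a : ps_convergent a -> a 0%N 0%N = 0 ->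
  exists2 r : C, 0 < r & forall N, ps_norm r a N <= 2^-1.
Proof.
move=> [r r0 [M h]] a0.
have M0 : 0 <= M by have := h 0%N; rewrite big_ord0.
have M1 : 0 < 2 * (M + 1) by rewrite mulr_gt0 ?ltr_wpDl.
(* The [+ 1] keeps the denominator positive when [M = 0], and [q * M <= 1/2] still holds. *)
pose q := (2 * (M + 1))^-1.
have q0 : 0 < q by rewrite invr_gt0.
have q1 : q <= 1.
  by rewrite invf_le1 // (le_trans (_ : 1 <= 2)) ?ler1n // ler_peMr // lerDr.
exists (q * r); first by rewrite mulr_gt0.
move=> N; apply: (@le_trans _ _ (q * M)); last first.
  rewrite mulrC ler_pdivrMr // mulrA mulVf ?pnatr_eq0 // mul1r.
  by rewrite lerDl.
apply: le_trans (ler_wpM2l (ltW q0) (h N)).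
rewrite mulr_sumr; apply: ler_sum => i _; rewrite mulr_sumr.
apply: ler_sum => j _; rewrite exprMn mulrCA.
have [/eqP|ij] := eqVneq (i + j)%N 0%N.
  by rewrite addn_eq0 => /andP[/eqP -> /eqP ->];
    rewrite a0 normr0 !(mul0r, mulr0).
rewrite ler_wpM2r ?mulr_ge0 ?exprn_ge0 ?(ltW r0) //.
by case: (i + j)%N ij => // k _;
  rewrite exprS ler_piMr ?(ltW q0) // exprn_ile1 // ltW.
Qed.

Lemma ps_exp_low a k i j : a 0%N 0%N = 0 -> (i + j < k)%N -> (a ^+ k) i j = 0.
Proof.
move=> a0; elim: k i j => // k IH i j ijk; rewrite exprS.
rewrite -[LHS]/(ps_mul a (a ^+ k) i j) /ps_mul big1 // => p _.
rewrite big1 // => q _.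
have [/eqP|pq] := eqVneq (p + q)%N 0%N.
  by rewrite addn_eq0 => /andP[/eqP -> /eqP ->]; rewrite a0 mul0r.
by rewrite IH ?mulr0 //; have := ltn_ord p; have := ltn_ord q; lia.
Qed.

(** The solution is the geometric series in [a]. It can be summed coefficientwise, since [a ^+ k]
    has no terms of degree below [k]. *)
Lemma ps_inv_exists a : a 0%N 0%N = 0 -> exists b, b = 1 + a * b.
Proof.
move=> a0; pose S N : pseries C := \sum_(k < N) a ^+ k.
have SS N : S N.+1 = 1 + a * S N.
  rewrite /S big_ord_recl expr0 mulr_sumr; congr (_ + _).
  by apply: eq_bigr => k _; rewrite lift0 exprS.
have SE i j N : (i + j < N)%N -> S N i j = S (i + j).+1 i j.
  elim: N => // N IH; rewrite ltnS leq_eqVlt => /predU1P[->//|lt].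
  rewrite -IH // {1}/S big_ord_recr /=.
  by rewrite -[LHS]/(S N i j + (a ^+ N) i j) ps_exp_low ?addr0.
exists (fun i j => S (i + j).+1 i j); apply/funext => i; apply/funext => j.
rewrite -(SE i j (i + j).+2) // SS; congr (_ + _).
apply: eq_ps_mul => // k l ki lj; apply: SE; lia.
Qed.

(** The formal inverse satisfies [b = 1 + a * b] with [a] of norm at most 1/2. So each truncated
    norm of [b] is at most 1 plus half of itself, hence at most 2, and [b] converges. *)
Lemma cps_unit (u : cps C) : coef u 0 0 = 1 -> exists w, w * u = 1.
Proof.
move=> u1; pose a : cps C := 1 - u.
have a0 : coef a 0 0 = 0 by rewrite /a cps_coefB u1 -mon00 coef_mon subrr.
have [b bE] := ps_inv_exists a0.
have [r r0 ha] := ps_norm_small (cps_convergent a) a0.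
have cb : ps_convergent b.
  exists r => //; exists 2 => N.
  have bN := ps_norm_ge0 b N (ltW r0).
  suff : ps_norm r b N <= 1 + 2^-1 * ps_norm r b N.
    rewrite -lerBlDr -{1}[ps_norm _ _ _]mul1r -mulrBl.
    have -> : 1 - 2^-1 = 2^-1 :> C by field.
    by rewrite -ler_pdivlMl ?invr_gt0 // invrK mulr1.
  apply: (@le_trans _ _ (ps_norm r 1 N + ps_norm r (coef a * b) N)).
    rewrite {1}bE -big_split /=; apply: ler_sum => i _.
    rewrite -big_split /=; apply: ler_sum => j _.
    by rewrite -mulrDl ler_wpM2r ?exprn_ge0 ?(ltW r0) // ler_normD.
  apply: lerD; last first.
    apply: le_trans (ps_normM _ _ _ (ltW r0)) _.
    by rewrite ler_wpM2r.
  rewrite /ps_norm; case: N {bN} => [|N]; first by rewrite big_ord0 ler01.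
  rewrite big_ord_recl big_ord_recl /= normr1 expr0 mulr1.
  rewrite !big1 ?addr0 // => [i _|i _]; last by rewrite normr0 mul0r.
  by rewrite big1 // => j _; rewrite normr0 mul0r.
pose w := CPS (asboolT cb).
have wE : w = 1 + a * w by apply: val_inj; apply: bE.
exists w; apply: (addIr (a * w)); rewrite -[RHS]wE /a mulrBl mul1r mulrC.
by rewrite addrC addrNK.
Qed.

End Units.

(** * The filtration of power series by weighted order *)

Section WeightFiltration.
Variables (C : numFieldType) (n m : nat).
Implicit Types u v w : cps C.

Definition Fil (k : nat) v : Prop :=
  forall i j, (n * i + m * j < k)%N -> coef v i j = 0.

Lemma Fil_le k l v : Fil k v -> (l <= k)%N -> Fil l v.
Proof. by move=> h lk i j ij; apply/h/leq_trans/lk. Qed.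

Lemma FilD k u v : Fil k u -> Fil k v -> Fil k (u + v).
Proof. by move=> hu hv i j ij; rewrite cps_coefD hu ?hv ?addr0. Qed.

Lemma FilB k u v : Fil k u -> Fil k v -> Fil k (u - v).
Proof. by move=> hu hv i j ij; rewrite cps_coefB hu ?hv ?subr0. Qed.

Lemma FilZ k (c : C) v : Fil k v -> Fil k (c *: v).
Proof. by move=> hv i j ij; rewrite cps_coefZ hv ?mulr0. Qed.

Lemma Fil_mon k i j : (k <= n * i + m * j)%N -> Fil k (mon C i j).
Proof.
move=> kij p q pq; rewrite coef_mon.
case: eqP => [ep|//]; case: eqP => [eq|//]; lia.
Qed.

Lemma FilM k l u v : Fil k u -> Fil l v -> Fil (k + l) (u * v).
Proof.
move=> hu hv i j ij; rewrite cps_coefM big1 // => p _; rewrite big1 // => q _.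
have [lt|ge] := ltnP (n * p + m * q) k; first by rewrite hu ?mul0r.
rewrite hv ?mulr0 // !mulnBr.
have := leq_ord p; have := leq_ord q => qj pi.
have := leq_mul (leqnn n) pi; have := leq_mul (leqnn m) qj; lia.
Qed.

Hypotheses (n_gt0 : (0 < n)%N) (m_gt0 : (0 < m)%N).

(* Weights are positive, so only finitely many monomials have weight k and the
   part of v of weight k is a polynomial. *)
Lemma Fil_induct (P : cps C -> Prop) k v :
  P 0 -> (forall u w, P u -> P w -> P (u + w)) ->
  (forall (c : C) u, P u -> P (c *: u)) ->
  (forall i j, (k <= n * i + m * j)%N ->
    exists2 p, P p & Fil (n * i + m * j).+1 (mon C i j - p)) ->
  Fil k v -> forall N, exists2 p, P p & Fil (k + N) (v - p).
Proof.
move=> P0 PD PZ Pmon hv; elim=> [|N [p Pp hp]].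
  by exists 0; rewrite ?addn0 ?subr0.
set l := (k + N)%N in hp *; set w := v - p in hp *.
(* Since [n] and [m] are positive, both exponents of a monomial of weight [l] are at most [l]. *)
pose b (x : 'I_l.+1 * 'I_l.+1) := (n * x.1 + m * x.2 == l)%N.
pose hom := \sum_(x | b x) coef w x.1 x.2 *: mon C x.1 x.2.
have hhom : Fil l.+1 (w - hom).
  move=> i j ij; rewrite cps_coefB cps_coef_sum.
  under eq_bigr => x _ do rewrite cps_coefZ coef_mon.
  have [lt|ge] := ltnP (n * i + m * j) l.
    rewrite hp // big1 ?subr0 // => x /eqP bx.
    case: eqP => [ei|]; last by rewrite mulr0.
    case: eqP => [ej|]; last by rewrite mulr0.
    by move: lt; rewrite ei ej bx ltnn.
  have ijl : (n * i + m * j)%N = l by lia.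
  have il : (i < l.+1)%N by nia.
  have jl : (j < l.+1)%N by nia.
  rewrite (bigD1 (Ordinal il, Ordinal jl)) /b ?ijl //= !eqxx.
  rewrite mulr1 big1 ?addr0 ?subrr // => x /andP[_ nx].
  case: eqP => [ei|]; last by rewrite mulr0.
  case: eqP => [ej|]; last by rewrite mulr0.
  by case/eqP: nx; case: x ei ej => x y /= ei ej; congr (_, _); apply: val_inj.
(* Replacing each monomial of [hom] by its approximation in [P] costs only terms of weight above
   [l]. *)
have [q Pq hq] : exists2 q, P q & Fil l.+1 (hom - q).
  apply: (big_rec (fun h => exists2 q, P q & Fil l.+1 (h - q))).
    by exists 0; rewrite ?subr0.
  move=> [i j] h /eqP /= bij [q Pq hq].
  have [|r Pr hr] := Pmon i j; first by rewrite bij leq_addr.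
  rewrite bij in hr.
  exists (coef w i j *: r + q); first by apply: PD => //; apply: PZ.
  by rewrite opprD addrACA -scalerBr; apply: FilD => //; apply: FilZ.
exists (p + q); first exact: PD.
rewrite addnS opprD addrA -/w -[w](subrK hom) -addrA.
exact: FilD.
Qed.

(** A monomial with both exponents below [k] has weight below [(n + m) * k]. So each monomial of [v]
    is divisible by [x^k], and goes into [a], or else by [y^k], and goes into [b]. *)
Lemma Fil_decomp k v : Fil ((n + m) * k) v ->
  exists a b, v = mon C k 0 * a + mon C 0 k * b.
Proof.
move=> hv; have [a aE] := exists_shiftx k v.
have [b bE] := exists_shifty k (v - mon C k 0 * a).
exists a, b; apply: cpsP => i j; rewrite cps_coefD !coef_monM !leq0n !andbT /=.
rewrite bE cps_coefB coef_monM !leq0n !andbT !subn0 !aE.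
case: (leqP k j) => kj; first by rewrite (subnK kj) addrC subrK.
case: (leqP k i) => [/subnK->|ki]; rewrite addr0 // hv // mulnDl; nia.
Qed.

End WeightFiltration.

(** * Membership in ideals with two or three generators *)

Lemma ideal_gen2P (A : comNzRingType) (p q v : A) :
  ideal_gen [:: p; q] v <-> exists a b, v = a * p + b * q.
Proof.
split=> [[c ->]|[a [b ->]]].
  by exists (c ord0), (c (lift ord0 ord0));
    rewrite !big_ord_recl big_ord0 addr0.
exists (fun i : 'I_2 => if i == ord0 then a else b).
by rewrite !big_ord_recl big_ord0 addr0.
Qed.

Lemma ideal_gen3P (A : comNzRingType) (p q r v : A) :
  ideal_gen [:: p; q; r] v <->
  exists a, ideal_gen [:: q; r] (v - a * p).
Proof.
split=> [[c ->]|[a /ideal_gen2P[b [c E]]]].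
  exists (c ord0); apply/ideal_gen2P.
  exists (c (lift ord0 ord0)), (c (lift ord0 (lift ord0 ord0))).
  by rewrite !big_ord_recl big_ord0 addr0 addrC addKr.
exists (fun i : 'I_3 => if i == ord0 then a else if i == 1 :> nat then b else
  c).
by rewrite !big_ord_recl big_ord0 addr0 -[LHS](subrKC (a * p)) E.
Qed.

(** * Normal forms modulo [fx] and [fy] *)

Section MilnorAlgebra.
Variables (C : numFieldType) (n' m' : nat) (fx fy r s : cps C).
Let n := n'.+1.
Let m := m'.+1.
Hypotheses (n'_gt0 : (0 < n')%N) (m'_gt0 : (0 < m')%N).
Hypotheses (fxE : fx = r - m%:R *: mon C m' 0)
           (fyE : fy = n%:R *: mon C 0 n' + s).
Hypotheses (hr : Fil n m (n * m').+1 r) (hs : Fil n m (m * n').+1 s).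
Implicit Types u v w p : cps C.

Let J v := exists a b, v = a * fx + b * fy.

Lemma J0 : J 0.
Proof. by exists 0, 0; rewrite !mul0r addr0. Qed.

Lemma JD u v : J u -> J v -> J (u + v).
Proof.
move=> [a [b ->]] [c [d ->]]; exists (a + c), (b + d).
by rewrite !mulrDl addrACA.
Qed.

Lemma JM u v : J v -> J (u * v).
Proof. by move=> [a [b ->]]; exists (u * a), (u * b);
  rewrite mulrDr !mulrA. Qed.

Lemma JZ (c : C) v : J v -> J (c *: v).
Proof. by rewrite -mulr_algl; apply: JM. Qed.

Lemma JB u v : J u -> J v -> J (u - v).
Proof. by rewrite -[- v]scaleN1r => hu hv; apply/JD/JZ. Qed.

Lemma J_fx : J fx.
Proof. by exists 1, 0; rewrite mul1r mul0r addr0. Qed.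

Lemma J_fy : J fy.
Proof. by exists 0, 1; rewrite mul1r mul0r add0r. Qed.

Definition Box p : Prop :=
  forall i j, (m' <= i)%N || (n' <= j)%N -> coef p i j = 0.

Lemma BoxD u v : Box u -> Box v -> Box (u + v).
Proof. by move=> hu hv i j ij; rewrite cps_coefD hu ?hv ?addr0. Qed.

Lemma BoxZ (c : C) v : Box v -> Box (c *: v).
Proof. by move=> hv i j ij; rewrite cps_coefZ hv ?mulr0. Qed.

(** The normal form has to keep the weight bound [k]: the rank estimate for multiplication by [f]
    rests on this. *)
Let red k v := exists p, [/\ Box p, Fil n m k p & J (v - p)].

(** A monomial divisible by [x^m'] or [y^n'] is cancelled up to higher weight by a multiple of [fx]
    or [fy], which has normal form 0. All other monomials are in the box. *)
Lemma red_induct k v : Fil n m k v ->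
  forall N, exists2 p, red k p & Fil n m (k + N) (v - p).
Proof.
apply: Fil_induct => //.
- by exists 0; split=> //; rewrite subr0; apply: J0.
- move=> u w [p [Bp Fp Jp]] [q [Bq Fq Jq]]; exists (p + q).
  split; [exact: BoxD | exact: FilD |].
  by rewrite opprD addrACA; apply: JD.
- move=> c u [p [Bp Fp Jp]]; exists (c *: p).
  by split; [exact: BoxZ | exact: FilZ | rewrite -scalerBr; apply: JZ].
move=> i j kij; have J_red u : J u -> red k u by exists 0; rewrite subr0.
have [mi|im] := leqP m' i.
  exists (- m%:R^-1 *: (mon C (i - m') j * fx)).
    by apply/J_red/JZ/JM/J_fx.
  have -> : mon C i j - (- m%:R^-1 *: (mon C (i - m') j * fx)) =
            m%:R^-1 *: (mon C (i - m') j * r).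
    rewrite fxE mulrBr -scalerAr monM subnK // addn0 scalerBr scalerA mulNr.
    by rewrite mulVf ?pnatr_eq0 // scaleN1r scaleNr opprK opprD opprK addrC
      addrNK.
  apply/FilZ; apply: (Fil_le (FilM (Fil_mon C (leqnn (n * (i - m') + m * j)))
    hr)).
  by rewrite addnS ltnS addnAC -mulnDr subnK.
have [nj|jn] := leqP n' j.
  exists (n%:R^-1 *: (mon C i (j - n') * fy)).
    by apply/J_red/JZ/JM/J_fy.
  have -> : mon C i j - n%:R^-1 *: (mon C i (j - n') * fy) =
            - n%:R^-1 *: (mon C i (j - n') * s).
    rewrite fyE mulrDr -scalerAr monM subnK // addn0 scalerDr scalerA.
    by rewrite mulVf ?pnatr_eq0 // scale1r scaleNr opprD addrA subrr add0r.
  apply/FilZ; apply: (Fil_le (FilM (Fil_mon C (leqnn (n * i + m * (j - n'))))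
    hs)).
  by rewrite addnS ltnS -addnA -mulnDr subnK.
exists (mon C i j); last by rewrite subrr.
exists (mon C i j); split; last by rewrite subrr; apply: J0.
  move=> p q pq; rewrite coef_mon.
  by case: eqP => [ep|//]; case: eqP => [eq|//]; lia.
exact: Fil_mon.
Qed.

Lemma Box_Fil_eq0 k p : (n * m' + m * n' <= k)%N -> Box p -> Fil n m k p ->
  p = 0.
Proof.
move=> hk Bp Fp; apply: cpsP => i j.
have [/Bp->//|] := boolP ((m' <= i) || (n' <= j))%N.
rewrite negb_or -!ltnNge => /andP[im jn]; rewrite Fp //.
by apply: leq_trans hk; rewrite -addnS leq_add // ?ltn_pmul2l // leq_mul2l ltnW.
Qed.

(** All box monomials have weight below [k], so a normal form in [Fil k] is zero and the
    approximation of [v] lies in [J]. *)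
Lemma Fil_sub_J_upto k v : (n * m' + m * n' <= k)%N -> Fil n m k v ->
  forall N, exists2 w, Fil n m N w & J (v - w).
Proof.
move=> hk hv N; have [p [q [Bq Fq Jq]] hp] := red_induct hv N.
move: Jq; rewrite (Box_Fil_eq0 hk Bq Fq) subr0 => Jp.
exists (v - p); last by rewrite subKr.
by apply: (Fil_le hp); apply: leq_addl.
Qed.

(* Nakayama's lemma for the ideal (x^k, y^k) modulo J. *)
Lemma Fil_sub_J : exists N, forall v, Fil n m N v -> J v.
Proof.
pose k := (n * m' + m * n')%N.
(* Carried up to weight [(n + m) * k.+1], the reduction leaves a remainder in the ideal generated by
   [x^(k+1)] and [y^(k+1)]. *)
have gen v : Fil n m k v -> exists a b,
    J (v - mon C 1 0 * a * mon C k 0 - mon C 0 1 * b * mon C 0 k).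
  move=> /(Fil_sub_J_upto (leqnn k)) /(_ ((n + m) * k.+1)%N).
  move=> [w /Fil_decomp[//|//|a [b ->]] Jv]; exists a, b.
  have ex : mon C k.+1 0 = mon C 1 0 * mon C k 0 by rewrite monM.
  have ey : mon C 0 k.+1 = mon C 0 1 * mon C 0 k by rewrite monM.
  move: Jv; rewrite ex ey; congr J; ring.
have [|a1 [b1 Jx]] := gen (mon C k 0); first by apply: Fil_mon; lia.
have [|a2 [b2 Jy]] := gen (mon C 0 k); first by apply: Fil_mon; lia.
set x := mon C 1 0 in Jx Jy; set y := mon C 0 1 in Jx Jy.
set X := mon C k 0 in Jx Jy; set Y := mon C 0 k in Jx Jy.
(* Modulo [J], [X] and [Y] solve a homogeneous linear system whose matrix is the identity modulo [x]
   and [y]. Its determinant is a unit, and Cramer's rule then puts [X] and [Y] in [J]. *)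
have [d dE] : exists d,
    d * ((1 - x * a1) * (1 - y * b2) - y * b1 * (x * a2)) = 1.
  apply: cps_unit; have c0 u v : coef (x * u) 0 0 = 0 /\ coef (y * v) 0 0 = 0.
    by rewrite /x /y !coef_monM.
  have -> : (1 - x * a1) * (1 - y * b2) - y * b1 * (x * a2)
    = 1 - x * (a1 * (1 - y * b2)) - y * (b2 + b1 * (x * a2)) by ring.
  by rewrite !cps_coefB (c0 _ 0).1 (c0 0 _).2 !subr0.
have cancel_unit Z :
    J (((1 - x * a1) * (1 - y * b2) - y * b1 * (x * a2)) * Z) -> J Z.
  by move=> /(JM d); rewrite (mulrA d) dE mul1r.
have JX : J X.
  apply: cancel_unit.
  have -> : ((1 - x * a1) * (1 - y * b2) - y * b1 * (x * a2)) * X =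
    (1 - y * b2) * (X - x * a1 * X - y * b1 * Y) +
    y * b1 * (Y - x * a2 * X - y * b2 * Y) by ring.
  by apply: JD; apply: JM.
have JY : J Y.
  apply: cancel_unit.
  have -> : ((1 - x * a1) * (1 - y * b2) - y * b1 * (x * a2)) * Y =
    (1 - x * a1) * (Y - x * a2 * X - y * b2 * Y) +
    x * a2 * (X - x * a1 * X - y * b1 * Y) by ring.
  by apply: JD; apply: JM.
exists ((n + m) * k)%N => v /Fil_decomp[//|//|a [b ->]].
by rewrite mulrC [_ * b]mulrC; apply: JD; apply: JM.
Qed.

(** The reduction is carried on until the remainder has weight so high that [Fil_sub_J] applies. *)
Lemma Box_reduction k v : Fil n m k v ->
  exists p, [/\ Box p, Fil n m k p & J (v - p)].
Proof.
move=> hv; have [N FJ] := Fil_sub_J.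
have [q [p [Bp Fp Jp]] hq] := red_induct hv N.
exists p; split=> //; rewrite -(subrK q v) -addrA; apply: JD => //.
by apply: FJ; apply: (Fil_le hq); apply: leq_addl.
Qed.

(* The lowest weight terms of a and b can be cancelled against each other by
   the trivial syzygy (fy, - fx), because the initial terms of fx and fy are
   coprime. *)
Lemma Box_J_lift k p : Box p -> J p -> exists a b,
  [/\ p = a * fx + b * fy, Fil n m (k - n * m') a & Fil n m (k - m * n') b].
Proof.
move=> Bp Jp; elim: k => [|k [a [b [pE Fa Fb]]]].
  by have [a [b pE]] := Jp; exists a, b; rewrite !sub0n; split.
have m0 : m%:R != 0 :> C by rewrite pnatr_eq0.
have n0 : n%:R != 0 :> C by rewrite pnatr_eq0.
(* [a * r] and [b * s] start above weight [k], so in weight [k] only the initial terms of [fx] and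
   [fy] count. *)
have lowest i j : (n * i + m * j)%N = k -> coef p i j =
    (if (n' <= j)%N then n%:R * coef b i (j - n')%N else 0) -
    (if (m' <= i)%N then m%:R * coef a (i - m')%N j else 0).
  move=> ijk.
  have h1 : coef (a * r) i j = 0.
    by apply: (FilM Fa hr); rewrite ijk; lia.
  have h2 : coef (b * s) i j = 0.
    by apply: (FilM Fb hs); rewrite ijk; lia.
  rewrite pE fxE fyE mulrBr mulrDr -!scalerAr !cps_coefD cps_coefN !cps_coefZ
    h1 h2 addr0 add0r.
  rewrite ![_ * mon _ _ _]mulrC !coef_monM !subn0 !leq0n andbT /= addrC.
  by congr (_ - _); case: ifP; rewrite ?mulr0.
(* [n * t * y^n'] is the part of [a] divisible by [y^n']. Subtracting [t * fy] removes the lowest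
   terms in this part. The other lowest terms of [a], and those of [b + t * fx], vanish because [p]
   has no terms outside the box. *)
have [t0 t0E] := exists_shifty n' a; pose t := n%:R^-1 *: t0.
have tE i j : n%:R * coef t i j = coef a i (j + n')%N.
  by rewrite cps_coefZ mulVKf.
have Ft : Fil n m (k - n * m' - m * n') t.
  move=> i j ij; apply: (mulfI n0); rewrite tE mulr0 Fa //.
  by rewrite mulnDr; lia.
have taE i j : (n' <= j)%N -> n%:R * coef t i (j - n')%N = coef a i j.
  by move=> nj; rewrite tE subnK.
exists (a - t * fy), (b + t * fx); split; first by rewrite pE; ring.
  move=> i j ij; have [lt|ge] := ltnP (n * i + m * j) (k - n * m').
    rewrite cps_coefB Fa // sub0r.
    rewrite fyE mulrDr -scalerAr cps_coefD cps_coefZ [t * mon _ _ _]mulrC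
      coef_monM subn0 leq0n andTb.
    rewrite (FilM Ft hs) ?addr0; last by lia.
    by case: ifP => [nj|]; rewrite ?mulr0 ?oppr0 // taE // Fa // oppr0.
  have ijk : (n * (i + m') + m * j)%N = k by rewrite mulnDr; lia.
  rewrite cps_coefB fyE mulrDr -scalerAr cps_coefD cps_coefZ [t * mon _ _
    _]mulrC coef_monM subn0 leq0n andTb.
  rewrite (FilM Ft hs) ?addr0; last by lia.
  case: ifP => [nj|nj]; first by rewrite taE // subrr.
  rewrite mulr0 subr0; have := lowest _ _ ijk.
  rewrite Bp ?leq_addl // nj ?leq_addl addnK sub0r => /esym/eqP.
  by rewrite oppr_eq0 mulf_eq0 (negPf m0) => /eqP.
move=> i j ij; rewrite cps_coefD fxE mulrBr -scalerAr cps_coefB cps_coefZ [t *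
  mon _ _ _]mulrC.
rewrite coef_monM subn0 andbT (FilM Ft hr) ?sub0r; last by lia.
have [lt|ge] := ltnP (n * i + m * j) (k - m * n').
  rewrite Fb // add0r; case: ifP => [mi|]; last by rewrite mulr0 oppr0.
  rewrite Ft ?mulr0 ?oppr0 // mulnBr.
  by have := leq_mul (leqnn n) mi; lia.
have ijk : (n * i + m * (j + n'))%N = k by rewrite mulnDr; lia.
have := lowest _ _ ijk; rewrite Bp ?leq_addl ?orbT // ?leq_addl addnK.
case: ifP => _ /esym/eqP; rewrite subr_eq0 => /eqP e; apply: (mulfI n0).
  by rewrite mulr0 mulrBr mulrCA tE e subrr.
by rewrite !mulr0 subr0 e.
Qed.

(** [Box_J_lift] puts [p] in every [Fil k]; a [k] just above the weight of a monomial kills its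
    coefficient. *)
Lemma Box_J_eq0 p : Box p -> J p -> p = 0.
Proof.
move=> Bp Jp; apply: cpsP => i j; pose k := (n * i + m * j).+1.
have [a [b [-> Fa Fb]]] := Box_J_lift k Bp Jp.
have Ffx : Fil n m (n * m') fx.
  rewrite fxE; apply: FilB; first exact: (Fil_le hr).
  by apply/FilZ/Fil_mon; rewrite muln0 addn0.
have Ffy : Fil n m (m * n') fy.
  rewrite fyE; apply: FilD; last exact: (Fil_le hs).
  by apply/FilZ/Fil_mon; rewrite muln0 add0n.
by rewrite cps_coefD (FilM Fa Ffx) ?(FilM Fb Ffy) ?addr0 ?cps_coef0 // /k; lia.
Qed.

End MilnorAlgebra.

(** * Lattice points in a triangle *)

Section LatticePoints.
Local Open Scope nat_scope.

(** The positive pairs are [(i + 1, j + 1)]. The ranges are those of the basis exponents and lose no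
    pair, since a first entry of at least [m] or a second of at least [n] violates the
    inequality. *)
Definition triangle_count (n m : nat) : nat :=
  \sum_(i < m.-1) \sum_(j < n.-1) (2 * (n * i.+1 + m * j.+1) < n * m).

Lemma triangle_countC n m : triangle_count n m = triangle_count m n.
Proof.
rewrite /triangle_count exchange_big /=.
by apply: eq_bigr => i _; apply: eq_bigr => j _; rewrite addnC [n * m]mulnC.
Qed.

Lemma sum_ltn_le k t : \sum_(i < k) (i < t) <= t.
Proof.
suff: \sum_(i < k) (i < t) <= minn k t by move/leq_trans; apply;
  apply: geq_minr.
elim: k => [|k IH]; first by rewrite big_ord0.
rewrite big_ord_recr /= !leq_min in IH *; move: (\sum_(i < k) _) IH => S.
by case: (ltnP k t); lia.
Qed.

(* Pairing the rows j and L - 1 - j puts the triangle and its image under the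
   central symmetry side by side in a rectangle of half the size. *)
Lemma triangle_count_lt_aux n m : 2 <= n -> n <= m ->
  8 * triangle_count n m < n.-1 * m.-1.
Proof.
(* [t j] is the largest [a] with [2 * (n * a + m * j.+1) < n * m], or 0 if there is none: the
   predecessor encodes strictness, and truncated subtraction covers empty rows. Rows from [L] on are
   empty. *)
move=> n2 nm; pose t j := (n * m - 2 * m * j.+1).-1 %/ (2 * n).
pose L := n.-1./2.
have Ln : (n = 2 * L + 1) \/ (n = 2 * L + 2).
  by have := odd_double_half n.-1; rewrite -/L; case: odd; lia.
have row j : \sum_(i < m.-1) (2 * (n * i.+1 + m * j.+1) < n * m) <= t j.
  apply: leq_trans (sum_ltn_le m.-1 _); apply: leq_sum => i _.
  case: ltnP => // h; rewrite lt0b /t leq_divRL; nia.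
have t0 j : L <= j -> t j = 0.
  by move=> Lj; rewrite /t divn_small //; nia.
have cL : triangle_count n m <= \sum_(j < L) t j.
  rewrite /triangle_count exchange_big /=.
  apply: (@leq_trans (\sum_(j < n.-1) t j)).
    by apply: leq_sum => j _; apply: row.
  rewrite -(big_mkord xpredT t) (@big_cat_nat _ _ _ L) //=; last by lia.
  rewrite big_mkord -[leqRHS]addn0 leq_add2l big_nat big1 //.
  by move=> j /andP[/t0].
have c2L : 2 * triangle_count n m <= \sum_(j < L) (t j + t (L - j.+1)).
  rewrite big_split /= mul2n -addnn leq_add //.
  by rewrite (reindex_inj rev_ord_inj) /= in cL.
(* The final strict inequality comes from [2 * L < n - 1] when [n] is even. When [n] is odd,
   [2 * L = n - 1] and one more unit is needed; it comes from [n * m - m <= n * (m - 1)], that is,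
   from [n <= m]. *)
have pair (j : 'I_L) : 2 * (t j + t (L - j.+1)) <= m.-1 - (n == 2 * L + 1).
  have jL := ltn_ord j.
  have ta := leq_divM (n * m - 2 * m * j.+1).-1 (2 * n).
  have tb := leq_divM (n * m - 2 * m * (L - j.+1).+1).-1 (2 * n).
  rewrite -/(t j) in ta; rewrite -/(t (L - j.+1)) in tb.
  move: (t j) (t (L - j.+1)) ta tb => a b ta tb.
  rewrite subnSK // -!mulnA in ta tb.
  have jE : m * j.+1 + m * (L - j) = m * L + m.
    by rewrite -mulnDr addSn subnKC ?mulnS ?(addnC m) // ltnW.
  have p0 : m <= m * j.+1 by rewrite leq_pmulr.
  have q0 : m <= m * (L - j) by rewrite leq_pmulr // subn_gt0.
  move: (m * j.+1) (m * (L - j)) jE p0 q0 ta tb => p q jE p0 q0 ta tb.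
  have nmE : n * m = 2 * (m * L) + m \/ n * m = 2 * (m * L) + m + m.
    by case: Ln => ->; [left | right]; ring.
  have abn : (2 * (a + b)) * n < 2 * (n * m) - 2 * (m * L + m) by lia.
  case: Ln => en.
    have -> : (n == 2 * L + 1) = true by lia.
    suff : 2 * (a + b) < m.-1 by lia.
    rewrite -(ltn_pmul2r (_ : 0 < n)); last by lia.
    apply: leq_trans abn _; rewrite en; rewrite en in nm; nia.
  have -> : (n == 2 * L + 1) = false by lia.
  suff : 2 * (a + b) < m by lia.
  rewrite -(ltn_pmul2r (_ : 0 < n)); last by lia.
  by apply: leq_trans abn _; rewrite en; nia.
have : 2 * (2 * triangle_count n m) <= L * (m.-1 - (n == 2 * L + 1)).
  apply: leq_trans (leq_mul (leqnn 2) c2L) _.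
  rewrite big_distrr /=.
  apply: (@leq_trans (\sum_(j < L) (m.-1 - (n == 2 * L + 1)))).
    by apply: leq_sum => j _; apply: pair.
  by rewrite sum_nat_const card_ord.
case: Ln => en; rewrite en; nia.
Qed.

Lemma triangle_count_lt n m : 2 <= n -> 2 <= m ->
  8 * triangle_count n m < n.-1 * m.-1.
Proof.
move=> n2 m2; have [nm|/ltnW mn] := leqP n m;
  first exact: triangle_count_lt_aux.
by rewrite triangle_countC [ltnRHS]mulnC; apply: triangle_count_lt_aux.
Qed.

End LatticePoints.

(** * Rank of a matrix with a zero block *)

Lemma mxrank_sum_le (F : fieldType) p q (I : finType) (A : {set I})
    (M : I -> 'M[F]_(p, q)) :
  (forall i, i \in A -> \rank (M i) <= 1)%N ->
    (\rank (\sum_(i in A) M i)%R <= #|A|)%N.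
Proof.
move=> h; rewrite -sum1_card.
elim/big_rec2: _ => [|i k N iA le]; first by rewrite mxrank0.
by apply: leq_trans (mxrank_add _ _) _; rewrite leq_add ?h.
Qed.

(** The matrix is a sum of matrices of rank at most 1, one for each row in [A] and one for each
    column in [B]. *)
Lemma mxrank_support (F : fieldType) p q (M : 'M[F]_(p, q))
    (A : {set 'I_p}) (B : {set 'I_q}) :
  (forall i j, i \notin A -> j \notin B -> M i j = 0) ->
  (\rank M <= #|A| + #|B|)%N.
Proof.
(* Clearing the rows in [A] keeps their entries from being counted again in the columns. *)
move=> h; pose N := \matrix_(i, j) if i \in A then 0 else M i j.
have -> : M = \sum_(i in A) delta_mx i 0 *m row i M +
              \sum_(j in B) col j N *m delta_mx 0 j.
  apply/matrixP => i j; rewrite mxE !summxE.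
  have e1 k : (delta_mx k 0 *m row k M) i j = if k == i then M i j else 0.
    by rewrite mxE big_ord1 !mxE eqxx andbT eq_sym; case: eqP => [->|];
      rewrite ?mul1r ?mul0r.
  have e2 k : (col k N *m delta_mx 0 k) i j = if k == j then N i j else 0.
    by rewrite mxE big_ord1 !mxE eqxx /= eq_sym; case: eqP => [->|];
      rewrite ?mulr1 ?mulr0.
  rewrite (eq_bigr _ (fun k _ => e1 k)) (eq_bigr _ (fun k _ => e2 k)).
  have e3 (I : finType) (D : {set I}) i0 (x : F) :
      \sum_(k in D) (if k == i0 then x else 0) = if i0 \in D then x else 0.
    rewrite -big_mkcondr /=; case: ifP => iD.
      by rewrite (big_pred1 i0) // => k /=; case: eqP => [->|];
        rewrite ?iD ?andbF.
    by rewrite big1 // => k /andP[kD /eqP ki]; rewrite -ki kD in iD.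
  rewrite !e3 mxE; case: ifP => [_|/negbT iA]; first by rewrite if_same addr0.
  by rewrite add0r; case: ifP => // /negbT jB; apply: h.
apply: leq_trans (mxrank_add _ _) _; apply: leq_add;
  apply: mxrank_sum_le => k _.
  exact: leq_trans (mxrankM_maxl _ _) (rank_leq_col _).
exact: leq_trans (mxrankM_maxl _ _) (rank_leq_col _).
Qed.

(** * Dimension of the quotient by a larger subspace *)

Section QuotientExtension.
Variables (K : fieldType) (V : lmodType K) (W W' : set V) (mu r : nat).
Variables (e : 'I_mu -> V) (M : 'M[K]_(r, mu)).
Let lin (c : 'rV[K]_mu) : V := \sum_j c 0 j *: e j.
Hypothesis span_e : forall v, exists c : 'I_mu -> K, W (v - \sum_i c i *: e i).
Hypothesis free_e :
  forall c : 'I_mu -> K, W (\sum_i c i *: e i) -> forall i, c i = 0.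
Hypothesis WB : forall u v, W u -> W v -> W (u - v).
Hypothesis WW' : forall v, W v -> W' v.
Hypothesis W'D : forall u v, W' u -> W' v -> W' (u + v).
Hypothesis W'Z : forall (c : K) u, W' u -> W' (c *: u).
Hypothesis M_W' : forall i, W' (lin (row i M)).
Hypothesis W'_M : forall w, W' w -> exists u : 'rV_r, W (w - lin (u *m M)).

Let linD c d : lin (c + d) = lin c + lin d.
Proof. by rewrite -big_split; apply: eq_bigr => j _; rewrite mxE scalerDl. Qed.

Let linZ k c : lin (k *: c) = k *: lin c.
Proof.
by rewrite scaler_sumr; apply: eq_bigr => j _; rewrite mxE scalerA.
Qed.

Let linB c d : lin (c - d) = lin c - lin d.
Proof. by rewrite linD -[- d]scaleN1r linZ scaleN1r. Qed.

Let lin_mul k (u : 'rV_k) (N : 'M_(k, mu)) :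
  lin (u *m N) = \sum_i u 0 i *: lin (row i N).
Proof.
rewrite mulmx_sum_row (big_morph lin linD (_ : lin 0 = 0)).
  by apply: eq_bigr => i _; rewrite linZ.
by rewrite /lin big1 // => j _; rewrite mxE scale0r.
Qed.

(** By [M_W'] and [W'_M], the rows of [M] are coordinates of vectors spanning [W'] modulo [W]. So a
    basis of a complement of the row space of [M] gives a basis modulo [W']. *)
Lemma quotient_dim_extend : quotient_dim W' (mu - \rank M).
Proof.
have W0 : W 0 by have [c hc] := span_e 0;
  rewrite -(subrr (0 - \sum_i c i *: e i)); apply: WB.
have W'lin u : W' (lin (u *m M)).
  rewrite lin_mul; elim/big_rec: _ => [|i v _ hv]; first exact: WW'.
  by apply: W'D => //; apply: W'Z.
rewrite -mxrank_compl; set B := row_base (M^C)%MS.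
exists (fun k => lin (row k B)); split=> [v|c].
  have [c hc] := span_e v; pose cv : 'rV_mu := \row_j c j.
  have : (cv <= M + M^C)%MS by apply: submx_full (addsmx_compl_full M).
  case/sub_addsmxP => -[u1 u2] /= cvE.
  have /submxP[d dE] : (u2 *m M^C <= B)%MS by rewrite eq_row_base submxMl.
  exists (fun k => d 0 k); rewrite -lin_mul -dE.
  have -> : lin (u2 *m M^C)%MS = lin cv - lin (u1 *m M) by rewrite cvE linD
    addrC addKr.
  rewrite opprB addrCA addrC; apply: W'D => //; apply: WW'.
  by congr W: hc; congr (_ - _); apply: eq_bigr => j _; rewrite mxE.
pose cv := \row_k c k.
have -> : \sum_k c k *: lin (row k B) = lin (cv *m B).
  by rewrite lin_mul; apply: eq_bigr => k _; rewrite mxE.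
case/W'_M => u; rewrite -linB => /free_e eq0.
have cvB : cv *m B = u *m M.
  by apply/eqP; rewrite -subr_eq0; apply/eqP/rowP => j; rewrite eq0 mxE.
have : (cv *m B <= M :&: M^C)%MS.
  by rewrite sub_capmx {1}cvB submxMl (submx_trans (submxMl _ _)) ?eq_row_base.
rewrite capmx_compl submx0 mulmx_free_eq0 ?row_base_free // => /eqP cv0 k.
by move/rowP: cv0 => /(_ k); rewrite !mxE.
Qed.

End QuotientExtension.

(** * Milnor and Tjurina numbers of the germ *)

Section SemiQuasiHomogeneous.
Variables (C : numFieldType) (n' m' : nat) (f : cps C).
Let n := n'.+1.
Let m := m'.+1.
Hypotheses (n'_gt0 : (0 < n')%N) (m'_gt0 : (0 < m')%N).
Hypothesis sqh_f : semi_quasi_homogeneous n m f.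

Let T : finType := ('I_m' * 'I_n')%type.
Let d := #|T|.
Let e (k : 'I_d) : cps C := mon C (enum_val k).1 (enum_val k).2.
Let weight (k : 'I_d) : nat := (n * (enum_val k).1 + m * (enum_val k).2)%N.

Lemma sqh_coef i j : (n * i + m * j <= n * m)%N ->
  coef f i j = ((i == 0) && (j == n))%N%:R - ((i == m) && (j == 0))%N%:R.
Proof.
have [g [-> hg]] := sqh_f; move=> ij.
rewrite cps_coefD cps_coefB exp_cpsX exp_cpsY !coef_mon.
have [->|/hg] := eqVneq (coef g i j) 0; first by rewrite addr0.
by rewrite ltnNge ij.
Qed.

(** The partial derivatives of [y^n - x^m] are [- m x^m'] and [n y^n']; [r] and [s] are what the
    higher terms of [f] add to them. *)
Let r := cps_dx f + m%:R *: mon C m' 0.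
Let s := cps_dy f - n%:R *: mon C 0 n'.

Let fxE : cps_dx f = r - m%:R *: mon C m' 0.
Proof. by rewrite addrK. Qed.

Let fyE : cps_dy f = n%:R *: mon C 0 n' + s.
Proof. by rewrite subrKC. Qed.

Let Fil_r : Fil n m (n * m').+1 r.
Proof.
move=> i j ij; rewrite cps_coefD cps_coefZ coef_mon -[coef (cps_dx f) i
  j]/(coef f i.+1 j *+ i.+1).
rewrite sqh_coef; last by rewrite mulnS [(n * m)%N]mulnS; lia.
rewrite sub0r eqSS; case: eqP => [->|_] /=;
  last by rewrite oppr0 mul0rn mulr0 addr0.
by rewrite -[_ *+ m'.+1]mulr_natl mulrN addNr.
Qed.

Let Fil_s : Fil n m (m * n').+1 s.
Proof.
move=> i j ij; rewrite cps_coefB cps_coefZ coef_mon -[coef (cps_dy f) i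
  j]/(coef f i j.+1 *+ j.+1).
rewrite sqh_coef; last by rewrite mulnS [(n * m)%N]mulnC [(m * n)%N]mulnS; lia.
rewrite andbF subr0 eqSS; case: (j =P n') => [->|_];
  last by rewrite andbF mul0rn mulr0 subr0.
by rewrite -[_ *+ n'.+1]mulr_natl subrr.
Qed.

Let J := ideal_gen [:: cps_dx f; cps_dy f].
Let J' := ideal_gen [:: f; cps_dx f; cps_dy f].

Let JP v : J v <-> exists a b, v = a * cps_dx f + b * cps_dy f.
Proof. exact: ideal_gen2P. Qed.

Let reduction k v : Fil n m k v ->
  exists p, [/\ Box n' m' p, Fil n m k p & J (v - p)].
Proof.
move=> hv.
have [p [Bp Fp /JP Jp]] := Box_reduction n'_gt0 m'_gt0 fxE fyE Fil_r Fil_s hv.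
by exists p.
Qed.

Let J_D u v : J u -> J v -> J (u + v).
Proof. by move=> /JP hu /JP hv; apply/JP; apply: JD. Qed.

Let J_M u v : J v -> J (u * v).
Proof. by move=> /JP hv; apply/JP; apply: JM. Qed.

Let J_B u v : J u -> J v -> J (u - v).
Proof. by move=> /JP hu /JP hv; apply/JP; apply: JB. Qed.

Let coef_lin (c : 'I_d -> C) i j (im : (i < m')%N) (jn : (j < n')%N) :
  coef (\sum_k c k *: e k) i j = c (enum_rank (Ordinal im, Ordinal jn)).
Proof.
rewrite cps_coef_sum; under eq_bigr => k _ do rewrite cps_coefZ coef_mon.
rewrite (bigD1 (enum_rank (Ordinal im, Ordinal jn))) //= enum_rankK !eqxx mulr1.
rewrite big1 ?addr0 // => k /eqP nk.
case: eqP => [ei|_]; last by rewrite mulr0.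
case: eqP => [ej|_]; last by rewrite mulr0.
case: nk; apply: enum_val_inj; rewrite enum_rankK.
by case: (enum_val k) ei ej => x y /= ei ej; congr (_, _); apply: val_inj.
Qed.

Let Box_lin (c : 'I_d -> C) : Box n' m' (\sum_k c k *: e k).
Proof.
move=> i j ij; rewrite cps_coef_sum big1 // => k _; rewrite cps_coefZ coef_mon.
case: eqP => [ei|_]; last by rewrite mulr0.
case: eqP => [ej|_]; last by rewrite mulr0.
by move: ij; rewrite ei ej leqNgt ltn_ord leqNgt ltn_ord.
Qed.

Let linE p : Box n' m' p ->
  p = \sum_(k : 'I_d) coef p (enum_val k).1 (enum_val k).2 *: e k.
Proof.
move=> Bp; apply: cpsP => i j.
have [ij|] := boolP ((m' <= i) || (n' <= j))%N; first by rewrite Bp // Box_lin.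
rewrite negb_or -!ltnNge => /andP[im jn].
by rewrite (coef_lin (fun k => _) im jn) enum_rankK.
Qed.

Let span_e v : exists c : 'I_d -> C, J (v - \sum_k c k *: e k).
Proof.
have [|p [Bp _ Jp]] := @reduction 0 v; first by [].
by exists (fun k : 'I_d => coef p (enum_val k).1 (enum_val k).2); rewrite -linE.
Qed.

Let free_e (c : 'I_d -> C) : J (\sum_k c k *: e k) -> forall k, c k = 0.
Proof.
move=> /JP Jc k.
have c0 := Box_J_eq0 n'_gt0 m'_gt0 fxE fyE Fil_r Fil_s (Box_lin c) Jc.
have := coef_lin c (ltn_ord (enum_val k).1) (ltn_ord (enum_val k).2).
rewrite c0 cps_coef0 (_ : (_, _) = enum_val k) ?enum_valK //.
by case: (enum_val k) => x y /=; congr (_, _); apply: val_inj.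
Qed.

Lemma sqh_milnor_number : milnor_number f (m' * n').
Proof.
have -> : (m' * n')%N = d by rewrite /d card_prod !card_ord.
by exists e; split; [exact: span_e | exact: free_e].
Qed.

(* The initial part f0 satisfies Euler's relation f0 = x f0_x / m + y f0_y / n. *)
Lemma sqh_euler : exists2 h, Fil n m (n * m).+1 h & J (f - h).
Proof.
pose u := m%:R^-1 *: mon C 1 0 * cps_dx f + n%:R^-1 *: mon C 0 1 * cps_dy f.
exists (f - u); last by rewrite subKr; apply: J_D; apply: J_M; apply/JP;
  [exact: J_fx | exact: J_fy].
have m0 : m%:R != 0 :> C by rewrite pnatr_eq0.
have n0 : n%:R != 0 :> C by rewrite pnatr_eq0.
move=> i j; rewrite ltnS => ij.
have dx : coef (mon C 1 0 * cps_dx f) i j = coef f i j *+ i.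
  rewrite coef_monM subn0 andbT; case: i {ij} => [|i]; first by rewrite mulr0n.
  by rewrite subSS subn0.
have dy : coef (mon C 0 1 * cps_dy f) i j = coef f i j *+ j.
  rewrite coef_monM subn0; case: j {ij dx} => [|j]; first by rewrite mulr0n.
  by rewrite subSS subn0.
(* The coefficient is that of [f] times [1 - i/m - j/n], and this factor vanishes at [x^m] and
   [y^n], the only monomials of [f] up to weight [n * m]. *)
rewrite cps_coefB cps_coefD -!scalerAl !cps_coefZ dx dy (sqh_coef ij).
case: (i =P 0%N) => [->|_]; case: (j =P 0%N) => [->|_];
  rewrite /= ?andbF ?andbT ?subr0 ?sub0r ?mulr0n ?mul0rn ?mulr0 ?subrr ?add0r
    ?addr0 ?sub0r ?oppr0 //.
- by case: eqP => [->|_]; rewrite ?mul0rn ?mulr0 ?subr0 ?mulVf ?subrr.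
- case: eqP => [->|_]; last by rewrite oppr0 mul0rn mulr0 subr0.
  by rewrite mulNrn mulrN mulVf // opprK addNr.
Qed.

Let S := [set x : T | 2 * (n * x.1.+1 + m * x.2.+1) < n * m]%N.

(** [M] is the matrix of multiplication by [f] modulo [J]. Computing it with [h] shows that row [k]
    vanishes in all columns of weight at most [n * m + weight k]. *)
Lemma sqh_tjurina_number : exists2 tau,
  tjurina_number f tau & (m' * n' <= tau + 2 * #|S|)%N.
Proof.
have [h Fh Jfh] := sqh_euler.
have Fe k : Fil n m (weight k) (e k) by apply: Fil_mon.
have /choice[p pP] k := reduction (FilM Fh (Fe k)).
pose M := \matrix_(k < d, l < d) coef (p k) (enum_val l).1 (enum_val l).2.
have linM k : \sum_l (row k M) 0 l *: e l = p k.
  by have [Bp _ _] := pP k; rewrite [RHS]linE //; apply: eq_bigr => l _;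
    rewrite !mxE.
have J'P v : J' v <-> exists a, J (v - a * f) by apply: ideal_gen3P.
have J_J' v : J v -> J' v by move=> Jv; apply/J'P; exists 0;
  rewrite mul0r subr0.
have J'_D u v : J' u -> J' v -> J' (u + v).
  move=> /J'P[a ha] /J'P[b hb]; apply/J'P; exists (a + b).
  by rewrite mulrDl opprD addrACA; apply: J_D.
have J'_Z c u : J' u -> J' (c *: u).
  move=> /J'P[a ha]; apply/J'P; exists (c%:A * a).
  have -> : c *: u - c%:A * a * f = c%:A * (u - a * f).
    by rewrite mulrBr [_ * u]mulr_algl mulrA.
  exact: J_M.
have fe_p k : J (f * e k - p k).
  have [_ _ hp] := pP k.
  by rewrite -[f](subrK h) mulrDl -addrA; apply: J_D => //; rewrite mulrC;
    apply: J_M.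
have hM1 k : J' (\sum_l (row k M) 0 l *: e l).
  rewrite linM; apply/J'P; exists (e k).
  by rewrite -opprB mulrC -sub0r; apply: J_B => //; apply/JP/J0.
(* Modulo [J], [w] is [a * f], and expanding [a] in the basis gives a combination of the [p k]. *)
have hM2 w : J' w -> exists u : 'rV_d, J (w - \sum_l (u *m M) 0 l *: e l).
  move=> /J'P[a wa]; have [c ac] := span_e a; exists (\row_k c k).
  have -> : \sum_l ((\row_k c k) *m M) 0 l *: e l = \sum_k c k *: p k.
    under eq_bigr => l _ do rewrite mxE scaler_suml.
    rewrite exchange_big /=; apply: eq_bigr => k _.
    rewrite -[in RHS]linM scaler_sumr; apply: eq_bigr => l _.
    by rewrite !mxE scalerA.
  have -> : w - \sum_k c k *: p k = (w - a * f) + f * (a - \sum_k c k *: e k) +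
      \sum_k c k *: (f * e k - p k).
    under [X in _ = _ + X]eq_bigr => k _ do rewrite scalerBr scalerAr.
    by rewrite sumrB -mulr_sumr; ring.
  apply: J_D; first by apply: J_D => //; apply: J_M.
  elim/big_rec: _ => [|k v _ Jv]; first exact/JP/J0.
  by apply: J_D => //; rewrite -mulr_algl; apply: J_M.
exists (d - \rank M)%N.
  by apply: (quotient_dim_extend span_e free_e J_B J_J' J'_D J'_Z hM1 hM2).
pose t := uphalf (n * m - 2 * n - 2 * m).
pose A := [set k | weight k < t]%N.
pose B := [set k | n * m + t < weight k]%N.
have rM : (\rank M <= #|A| + #|B|)%N.
  apply: mxrank_support => k l; rewrite !inE -leqNgt -leqNgt => kt lt;
    rewrite mxE.
  by have [_ Fp _] := pP k; apply: Fp;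
    rewrite addSn ltnS (leq_trans lt) ?leq_add2l.
have t2 : (n * m - 2 * n - 2 * m <= 2 * t <= (n * m - 2 * n - 2 * m).+1)%N.
  by rewrite /t; lia.
(* [weight k < t] forces [2 * weight k + 2 * n + 2 * m < n * m]; if the truncated difference in [t]
   is 0, then [A] is empty. *)
have cA : (#|A| <= #|S|)%N.
  rewrite -(card_imset _ enum_val_inj); apply: subset_leq_card;
    apply/fintype.subsetP => x.
  case/imsetP => k; rewrite !inE /weight (mulnS n) (mulnS m) => kt ->.
  move: (n * (enum_val k).1)%N (m * (enum_val k).2)%N kt => a b kt;
    move/andP: t2 => [t_ge t_le]; clearbody t; lia.
have cB : (#|B| <= #|S|)%N.
  (* The central symmetry of the box. With both exponents raised by 1, the image of a monomial of
     weight [w] has weight [2 * n * m - n - m - w], whose double is below [n * m] once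
     [w > n * m + t]. *)
  pose g (k : 'I_d) : T := (rev_ord (enum_val k).1, rev_ord (enum_val k).2).
  have g_inj : injective g.
    move=> k l /eqP; rewrite xpair_eqE =>
      /andP[/eqP/rev_ord_inj e1 /eqP/rev_ord_inj e2].
    apply: enum_val_inj; rewrite [LHS]surjective_pairing
      [RHS]surjective_pairing.
    by rewrite e1 e2.
  rewrite -(card_imset _ g_inj); apply: subset_leq_card;
    apply/fintype.subsetP => x.
  case/imsetP => k; rewrite !inE /weight => kt -> /=.
  rewrite !subnSK ?ltn_ord // !mulnBr.
  have := leq_mul (leqnn n) (ltnW (ltn_ord (enum_val k).1)).
  have := leq_mul (leqnn m) (ltnW (ltn_ord (enum_val k).2)).
  move: (n * (enum_val k).1)%N (m * (enum_val k).2)%N kt => a b kt.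
  have nm1 : (n * m = n * m' + n)%N by rewrite mulnS addnC.
  have nm2 : (n * m = m * n' + m)%N by rewrite mulnC mulnS addnC.
  move/andP: t2 => [t_ge t_le]; clearbody t; lia.
have -> : (m' * n')%N = d by rewrite /d card_prod !card_ord.
lia.
Qed.

Lemma card_triangle : #|S| = triangle_count n m.
Proof.
rewrite /triangle_count pair_big /= -sum1_card big_mkcond /=.
by apply: eq_bigr => x _; rewrite inE; case: ltnP.
Qed.

End SemiQuasiHomogeneous.

Theorem proposition2 (R : realType) (n m : nat) (f : cps R[i]) :
  (2 <= n)%N -> (2 <= m)%N ->
  semi_quasi_homogeneous n m f ->
  exists mu tau : nat,
    [/\ milnor_number f mu, tjurina_number f tau &
        mu%:R / tau%:R < 4 / 3 :> rat].
Proof.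
case: n m => [//|n] [//|m]; rewrite !ltnS => n0 m0 sqh_f.
have [tau Htau le_tau] := sqh_tjurina_number n0 m0 sqh_f.
exists (m * n)%N, tau; split=> //; first exact: sqh_milnor_number.
rewrite card_triangle in le_tau.
have lt : (8 * triangle_count n.+1 m.+1 < n * m)%N.
  exact: (@triangle_count_lt n.+1 m.+1).
(* With [c] the triangle count, [mu <= tau + 2 * c] and [8 * c < mu] give
   [4 * tau >= 4 * mu - 8 * c > 3 * mu]. *)
have ltau : (3 * (m * n) < 4 * tau)%N by rewrite [(n * m)%N]mulnC in lt; lia.
(* Clearing denominators needs [tau] positive; a quotient by 0 would just be 0. *)
have tau0 : (0 < tau)%N by lia.
rewrite ltr_pdivrMr ?ltr0n // mulrAC ltr_pdivlMr // mulrC -!natrM ltr_nat.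
exact: ltau.
Qed.
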